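(* Let $(X,T)$ be a dynamical system and let $x\in X$ be such that $\overline{\mathrm{Orb}(x,T)}=X$. Then a point $y\in X$ is multi-non-wandering if and only if $N(x,U)$ is an AP-set for every neighborhood $U$ of $y$.
   Context: A (topological) dynamical system $(X,T)$ consists of a (nonempty) compact metric space and a continuous map $T\colon X\to X$. $\mathbb{N}$ is the set of positive integers, $\mathrm{Orb}(x,T)=\{T^nx:n=0,1,2,\dots\}$, and $N(x,U)=\{n\in\mathbb{N}:T^nx\in U\}$. A set $F\subset\mathbb{N}$ is an AP-set if for every $d\ge1$ there are $a,n\in\mathbb{N}$ with $\{a,a+n,\dots,a+dn\}\subset F$. A point $y\in X$ is multi-non-wandering if for every open neighborhood $U$ of $y$ and every $d\in\mathbb{N}$ there exists $n\in\mathbb{N}$ such that $U\cap T^{-n}U\cap T^{-2n}U\cap\dots\cap T^{-dn}U\ne\emptyset$. *)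

(* Defs.v *)
From mathcomp Require Import all_boot all_order all_algebra.
From mathcomp Require Import all_classical all_reals all_analysis.

Set Implicit Arguments.
Unset Strict Implicit.
Unset Printing Implicit Defensive.

Local Open Scope classical_set_scope.

(* The paper's natural numbers are the positive integers; since [nat] contains
   0, positivity is imposed explicitly below. The orbit, on the other hand,
   starts at time 0. *)

Definition forward_orbit {X : Type} (T : X -> X) (x : X) : set X :=
  [set iter n T x | n in [set: nat]].

Definition hitting_times {X : Type} (T : X -> X) (x : X) (U : set X) : set nat :=
  [set n | (0 < n)%N /\ U (iter n T x)].

Definition AP_set (F : set nat) : Prop :=
  forall d : nat, (0 < d)%N ->
    exists a n : nat, [/\ (0 < a)%N, (0 < n)%N &
      forall i : nat, (i <= d)%N -> F (a + i * n)%N].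

(* The index i = 0 of the intersection contributes U itself. *)
Definition multi_non_wandering {X : topologicalType} (T : X -> X) (y : X) :
    Prop :=
  forall U : set X, open_nbhs y U ->
  forall d : nat, (0 < d)%N ->
    exists n : nat, (0 < n)%N /\
      \bigcap_(i in [set i : nat | (i <= d)%N]) (iter (i * n) T @^-1` U) !=set0.

(* Main.v *)
Require Import Defs.
From mathcomp Require Import all_boot all_order all_algebra.
From mathcomp Require Import all_classical all_reals all_analysis.

(** If the times [a + i * n], [i <= d], all bring [x] into [U], then the point
    [iter a T x] witnesses that [U] meets its preimages under
    [iter (i * n) T].  Conversely, such a finite intersection of preimages of an
    open [U] is itself open, so as soon as it is nonempty the dense orbit of [x]
    enters it, at some time [a], and [a + i * n] is then a progression of hitting
    times.  Density may only yield [a = 0], which is not an admissible hitting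
    time; starting from a progression with one extra term and dropping its first
    term replaces [a] by [a + n > 0]. *)

Local Open Scope classical_set_scope.

Lemma continuous_iter {X : topologicalType} {T : X -> X} (n : nat) :
  continuous T -> continuous (iter n T).
Proof.
move=> contT; elim: n => [|n IHn] z; first exact: cvg_id.
exact: (continuous_comp (IHn z) (contT _)).
Qed.

(** Openness of the intersection matters because density only gives orbit points
    in neighborhoods; the finiteness of the range of [i] is used through the
    induction on [d]. *)
Lemma nbhs_bigcap_iter_preimage {X : topologicalType} {T : X -> X}
    {U : set X} {n d : nat} {z : X} :
  continuous T -> open U ->
  (\bigcap_(i in [set i : nat | (i <= d)%N]) (iter (i * n) T @^-1` U)) z ->
  nbhs z (\bigcap_(i in [set i : nat | (i <= d)%N]) (iter (i * n) T @^-1` U)).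
Proof.
move=> contT openU; elim: d => [|d IHd] Vz.
  have U0 : nbhs z U by apply: open_nbhs_nbhs; split=> //; exact: (Vz 0).
  by apply: filterS U0 => w Uw i /=; rewrite leqn0 => /eqP ->.
have Ud : nbhs z (iter (d.+1 * n) T @^-1` U).
  apply: (continuous_iter (d.+1 * n) contT).
  by apply: open_nbhs_nbhs; split=> //; exact: (Vz d.+1 (leqnn _)).
have Vd : nbhs z
    (\bigcap_(i in [set i : nat | (i <= d)%N]) (iter (i * n) T @^-1` U)).
  by apply: IHd => i /= le_id; apply: Vz; exact: leqW.
apply: filterS2 Ud Vd => w Uw Vw i /=.
by rewrite leq_eqVlt => /orP[/eqP -> //|]; exact: Vw.
Qed.

(** An orbit point [iter a T x] lying in the intersection of the preimages of [U]
    encodes a whole progression of visits of [x] to [U], with difference [n]. *)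
Lemma multi_non_wandering_AP_hitting_times {X : topologicalType} {T : X -> X}
    {x y : X} {U : set X} :
  continuous T -> closure (forward_orbit T x) = [set: X] ->
  multi_non_wandering T y -> nbhs y U -> AP_set (hitting_times T x U).
Proof.
move=> contT dense_orbit nwy nbhsU d _.
have openU : open_nbhs y U°.
  by split; [exact: open_interior | exact: nbhsU].
(* The term of index 0 among these [d + 2] will be discarded. *)
have [n [n_gt0 [z Vz]]] := nwy _ openU d.+1 isT.
have : closure (forward_orbit T x) z by rewrite dense_orbit.
case/(_ _ (nbhs_bigcap_iter_preimage contT openU.1 Vz)) => _ [[a _ <-] Va].
exists (a + n)%N, n; split=> //; first by rewrite addn_gt0 n_gt0 orbT.
move=> i le_id; split; first by rewrite -addnA !addn_gt0 n_gt0 orbT.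
rewrite -addnA -mulSn addnC iterD; apply: interior_subset.
exact: Va.
Qed.

Lemma AP_hitting_times_multi_non_wandering {X : topologicalType} {T : X -> X}
    {x y : X} :
  (forall U : set X, nbhs y U -> AP_set (hitting_times T x U)) ->
  multi_non_wandering T y.
Proof.
move=> apU U /open_nbhs_nbhs nbhsU d d_gt0.
have [a [n [_ n_gt0 hit]]] := apU U nbhsU d d_gt0.
exists n; split=> //; exists (iter a T x) => i /hit[_].
by rewrite addnC iterD.
Qed.

Theorem proposition6p2 (R : realType) (X : metricType R) (T : X -> X)
  (compactX : compact [set: X]) (contT : continuous T)
  (x : X) (dense_orbit : closure (forward_orbit T x) = [set: X]) (y : X) :
  multi_non_wandering T y <->
  (forall U : set X, nbhs y U -> AP_set (hitting_times T x U)).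
Proof.
split; last exact: AP_hitting_times_multi_non_wandering.
by move=> nwy U; exact: multi_non_wandering_AP_hitting_times.
Qed.
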